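(* Let $A\in M_n(\mathbb{Z})$ be a matrix with nonzero determinant all of whose entries are non-negative, so that the associated monomial map $f_A$ is a polynomial map. Then $f_A$ is strongly algebraically stable on $(\mathbb{P}^1)^n$, hence algebraically stable on $(\mathbb{P}^1)^n$.
   Context: For $A=(a_{i,j})\in M_n(\mathbb{Z})$, $f_A(x_1,\dots,x_n)=(\prod_j x_j^{a_{1,j}},\dots,\prod_j x_j^{a_{n,j}})$; it induces a rational self map of $X=(\mathbb{P}^1)^n$ through the embedding $\mathbb{C}^n\hookrightarrow(\mathbb{P}^1)^n$, and $f_A^k=f_{A^k}$. As a toric variety, $(\mathbb{P}^1)^n=X(\Sigma)$, where $\Sigma$ is the fan in $\mathbb{R}^n$ (lattice $N=\mathbb{Z}^n$, on which $A$ acts by left multiplication on column vectors) whose maximal cones are generated by $\{s_1e_1,\dots,s_ne_n\}$, $s_i\in\{1,-1\}$, and whose other cones are the faces of these. $\mathrm{CDiv}_T(X)_{\mathbb{Q}}$ is the $\mathbb{Q}$-vector space of torus-invariant $\mathbb{Q}$-Cartier divisors on $X$, and $\mathrm{Pic}(X)_{\mathbb{Q}}=\mathrm{Pic}(X)\otimes\mathbb{Q}$. Pull back: choose a refinement $\widetilde\Sigma$ of $\Sigma$ such that $A$ maps every cone of $\widetilde\Sigma$ into a cone of $\Sigma$; let $\pi:X(\widetilde\Sigma)\to X$ be induced by the identity and $\widetilde f_A:X(\widetilde\Sigma)\to X$ be induced by $A$; then $f_A^*D:=\pi_*(\widetilde f_A^*D)$, which also induces a map on $\mathrm{Pic}(X)_{\mathbb{Q}}$.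 The map $f_A$ is strongly algebraically stable if $(f_A^k)^*=(f_A^* )^k$ on $\mathrm{CDiv}_T(X)_{\mathbb{Q}}$ for all positive integers $k$, and algebraically stable if $(f_A^k)^*=(f_A^* )^k$ on $\mathrm{Pic}(X)_{\mathbb{Q}}$ for all positive integers $k$. *)

(* Defs.v *)
From HB Require Import structures.
From mathcomp Require Import all_boot all_order all_algebra.
From mathcomp Require Import ring_quotient ring lra zify.
From mathcomp Require Import all_classical reals.

Set Implicit Arguments.
Unset Strict Implicit.
Unset Printing Implicit Defensive.

Import Order.TTheory GRing.Theory Num.Theory.

Local Open Scope classical_set_scope.
Local Open Scope ring_scope.

Section Fans.
Variables (R : realType) (n : nat).
Implicit Types (v : 'cV[int]_n) (x : 'cV[R]_n) (sigma tau : set 'cV[R]_n).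

Definition real_cV v : 'cV[R]_n := map_mx intr v.

Definition cone_of (s : seq 'cV[int]_n) : set 'cV[R]_n :=
  [set x | exists2 c : 'cV[int]_n -> R,
     forall v, 0 <= c v & x = \sum_(v <- s) c v *: real_cV v].

Definition rational_polyhedral sigma := exists s, sigma = cone_of s.

Definition strongly_convex sigma := forall x, sigma x -> sigma (- x) -> x = 0.

Definition dual_cone sigma : set 'rV[R]_n :=
  [set u | forall x, sigma x -> 0 <= (u *m x) 0 0].

Definition face tau sigma :=
  exists2 u, dual_cone sigma u & tau = sigma `&` [set x | u *m x = 0].

Record fan := Fan {
  cones : set (set 'cV[R]_n);
  fan_finite : finite_set cones;
  fan_polyhedral : forall sigma, cones sigma -> rational_polyhedral sigma;
  fan_strongly_convex : forall sigma, cones sigma -> strongly_convex sigma;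
  fan_face : forall sigma tau, cones sigma -> face tau sigma -> cones tau;
  fan_capl : forall sigma tau, cones sigma -> cones tau ->
    face (sigma `&` tau) sigma;
  fan_capr : forall sigma tau, cones sigma -> cones tau ->
    face (sigma `&` tau) tau
}.

Definition fan_support (S : fan) : set 'cV[R]_n := \bigcup_(sigma in cones S) sigma.

Definition refines (S' S : fan) :=
  fan_support S' = fan_support S /\
  forall sigma', cones S' sigma' -> exists2 sigma, cones S sigma & sigma' `<=` sigma.

Definition maps_cones_into (A : 'M[int]_n) (S' S : fan) :=
  forall sigma', cones S' sigma' -> exists2 sigma, cones S sigma &
    forall x, sigma' x -> sigma (map_mx intr A *m x).

Definition primitive v :=
  forall d : nat, (forall i, (d %| `|v i ord0|)%N) -> d = 1%N.

(* A ray of [S], represented by its primitive generator. *)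
Definition ray (S : fan) :=
  {v : 'cV[int]_n | `[< primitive v /\ cones S (cone_of [:: v]) >]}.

Lemma ray_cone (S : fan) (r : ray S) : cones S (cone_of [:: val r]).
Proof. by case: (asboolP _ (valP r)). Qed.

End Fans.
Arguments cone_of R [n] s _.
Arguments real_cV R [n] v.

Section ConeLemmas.
Variables (R : realType) (n : nat).
Implicit Types (s : seq 'cV[int]_n) (x y : 'cV[R]_n) (C : set 'cV[R]_n).

Definition convex_cone C :=
  [/\ C 0, (forall x y, C x -> C y -> C (x + y))
    & forall (a : R) x, 0 <= a -> C x -> C (a *: x)].

Lemma convex_cone_of s : convex_cone (cone_of R s).
Proof.
split.
- exists (fun=> 0) => //; rewrite big1 // => v _; exact: scale0r.
- move=> _ _ [c c0 ->] [d d0 ->]; exists (fun v => c v + d v).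
    by move=> v; rewrite addr_ge0.
  by rewrite -big_split /=; apply: eq_bigr => v _; rewrite scalerDl.
- move=> a _ a0 [c c0 ->]; exists (fun v => a * c v).
    by move=> v; rewrite mulr_ge0.
  by rewrite scaler_sumr; apply: eq_bigr => v _; rewrite scalerA.
Qed.

Lemma convex_cone_sum C (I : Type) (r : seq I) (P : pred I) (F : I -> 'cV[R]_n) :
  convex_cone C -> (forall i, P i -> C (F i)) -> C (\sum_(i <- r | P i) F i).
Proof. by case=> C0 CD _ CF; elim/big_ind: _. Qed.

Lemma mem_cone_of s v : v \in s -> cone_of R s (real_cV R v).
Proof.
move=> vs; exists (fun w => if w == v then (count_mem v s)%:R^-1 else 0).
  by move=> w; case: ifP => // _; rewrite invr_ge0 ler0n.
rewrite (eq_bigr (fun w => if w == v then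
   (count_mem v s)%:R^-1 *: real_cV R v else 0)); last first.
  by move=> w _; case: eqP => [->//|_]; rewrite scale0r.
rewrite -big_mkcond /= big_const_seq iter_addr_0 -scaler_nat scalerA mulfV ?scale1r //.
by rewrite pnatr_eq0 -lt0n -has_count has_pred1.
Qed.

Lemma cone_of_sub s C : convex_cone C ->
  (forall v, v \in s -> C (real_cV R v)) -> cone_of R s `<=` C.
Proof.
move=> cC sC _ [c c0 ->]; rewrite big_seq; apply: convex_cone_sum => // v /sC Cv.
by case: cC => _ _; apply.
Qed.

Definition hrep (us : seq 'rV[int]_n) : set 'cV[R]_n :=
  [set x | forall u, u \in us -> 0 <= (map_mx intr u *m x) 0 0].

Lemma pairD (u : 'rV[R]_n) x y : (u *m (x + y)) 0 0 = (u *m x) 0 0 + (u *m y) 0 0.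
Proof. by rewrite mulmxDr mxE. Qed.

Lemma pairZ (u : 'rV[R]_n) a x : (u *m (a *: x)) 0 0 = a * (u *m x) 0 0.
Proof. by rewrite -scalemxAr mxE. Qed.

Lemma pair_int (u : 'rV[int]_n) (v : 'cV[int]_n) :
  (map_mx intr u *m real_cV R v) 0 0 = ((u *m v) 0 0)%:~R.
Proof. by rewrite -map_mxM mxE. Qed.

Lemma pair_sum (u : 'rV[R]_n) (I : Type) (r : seq I) (P : pred I) (F : I -> 'cV[R]_n) :
  (u *m \sum_(i <- r | P i) F i) 0 0 = \sum_(i <- r | P i) (u *m F i) 0 0.
Proof. by rewrite mulmx_sumr summxE. Qed.

Lemma pair0 (u : 'rV[R]_n) : (u *m (0 : 'cV[R]_n)) 0 0 = 0.
Proof. by rewrite mulmx0 mxE. Qed.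

Lemma hrep_convex us : convex_cone (hrep us).
Proof.
split.
- by move=> u _; rewrite pair0.
- by move=> x y hx hy u uu; rewrite pairD addr_ge0 ?hx ?hy.
- by move=> a x a0 hx u uu; rewrite pairZ mulr_ge0 ?hx.
Qed.

Lemma convex_coneI C D : convex_cone C -> convex_cone D -> convex_cone (C `&` D).
Proof.
case=> C0 CD CZ [D0 DD DZ]; split=> //.
- by move=> x y [? ?] [? ?]; split; [exact: CD|exact: DD].
- by move=> a x a0 [? ?]; split; [exact: CZ|exact: DZ].
Qed.

(* One step of the double description method. *)
Lemma cone_of_half s (u : 'rV[int]_n) :
  rational_polyhedral (cone_of R s `&` hrep [:: u]).
Proof.
pose e (v : 'cV[int]_n) : int := (u *m v) 0 0.
pose s' := [seq v <- s | 0 <= e v] ++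
  [seq e v *: w - e w *: v | v <- [seq v <- s | 0 < e v], w <- [seq w <- s | e w < 0]].
exists s'; apply/seteqP; split; last first.
  apply: cone_of_sub.
    by apply: convex_coneI; [exact: convex_cone_of|exact: hrep_convex].
  have [C0 CD CZ] := convex_cone_of s.
  move=> v; rewrite mem_cat => /orP[|/allpairsP[[a b] /= []]].
    rewrite mem_filter => /andP[ev vs]; split; first exact: mem_cone_of.
    by move=> w; rewrite inE => /eqP ->; rewrite pair_int ler0z.
  rewrite !mem_filter => /andP[ea sa] /andP[eb sb] ->; split; last first.
    move=> w; rewrite inE => /eqP ->; rewrite pair_int ler0z.
    rewrite mulmxBr -!scalemxAr [leRHS]mxE [X in _ + X]mxE [X in X - _]mxE.
    by rewrite [X in _ - X]mxE -/(e a) -/(e b) [e b * _]mulrC subrr.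
  have -> : real_cV R (e a *: b - e b *: a) =
     (e a)%:~R *: real_cV R b + (- e b)%:~R *: real_cV R a.
    by apply/matrixP => i j; rewrite !mxE rmorphB !rmorphM rmorphN mulNr.
  apply: CD; apply: CZ; rewrite ?ler0z ?oppr_ge0 ?ltW //; exact: mem_cone_of.
move=> _ [[c c0 ->] hx].
have [C0 CD CZ] := convex_cone_of s'.
set x := \sum_(v <- s) _ in hx *.
pose P := \sum_(v <- s | 0 < e v) c v * (e v)%:~R.
pose N := \sum_(w <- s | e w < 0) c w * (- e w)%:~R.
pose p := \sum_(v <- s | 0 < e v) c v *: real_cV R v.
pose q := \sum_(w <- s | e w < 0) c w *: real_cV R w.
pose z := \sum_(v <- s | e v == 0) c v *: real_cV R v.
have xE : x = z + p + q.
  rewrite /x (bigID (fun v => e v == 0)) /= -addrA; congr (_ + _).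
  rewrite (bigID (fun v => 0 < e v)) /=; congr (_ + _); apply: eq_bigl => v.
    by case: (ltgtP (e v) 0).
  by case: (ltgtP (e v) 0).
have mempos v : v \in s -> 0 <= e v -> cone_of R s' (real_cV R v).
  by move=> vs ev; apply: mem_cone_of; rewrite mem_cat mem_filter ev vs.
have PN : 0 <= P - N.
  have := hx u (mem_head _ _); rewrite xE !pairD !pair_sum.
  rewrite [X in X + _ + _]big1 => [|v /eqP ev]; last first.
    by rewrite pairZ pair_int -/(e v) ev mulr0.
  rewrite add0r; congr (0 <= _ + _).
    by apply: eq_bigr => v _; rewrite pairZ pair_int.
  by rewrite /N -sumrN; apply: eq_bigr => v _; rewrite pairZ pair_int rmorphN mulrN opprK.
have N0 : 0 <= N.
  by apply: sumr_ge0 => w ew; rewrite mulr_ge0 // ler0z oppr_ge0 ltW.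
have zC : cone_of R s' z.
  rewrite /z big_seq_cond; apply: convex_cone_sum; first exact: convex_cone_of.
  by move=> v /andP[vs /eqP ev]; apply: CZ => //; apply: mempos; rewrite ?ev.
have pC : cone_of R s' p.
  rewrite /p big_seq_cond; apply: convex_cone_sum; first exact: convex_cone_of.
  by move=> v /andP[vs ev]; apply: CZ => //; apply: mempos => //; exact: ltW.
have [N_eq0|NN0] := eqVneq N 0.
  have -> : x = z + p.
    rewrite xE [q]big1_seq ?addr0 // => w /andP[ew ws].
    suff /eqP -> : c w == 0 by rewrite scale0r.
    move/eqP: N_eq0; rewrite psumr_eq0; last first.
      by move=> v ev; rewrite mulr_ge0 // ler0z oppr_ge0 ltW.
    move/allP/(_ _ ws)/implyP/(_ ew); rewrite mulf_eq0 intr_eq0 oppr_eq0.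
    by rewrite (lt_eqF ew) orbF.
  exact: CD.
have Np : 0 < N by rewrite lt_def NN0.
have Pp : 0 < P by rewrite (lt_le_trans Np) // -subr_ge0.
pose t := \sum_(v <- s | 0 < e v) \sum_(w <- s | e w < 0)
   (c v * c w / P) *: real_cV R (e v *: w - e w *: v).
have tC : cone_of R s' t.
  rewrite /t big_seq_cond; apply: convex_cone_sum; first exact: convex_cone_of.
  move=> v /andP[vs ev]; rewrite big_seq_cond; apply: convex_cone_sum; first exact: convex_cone_of.
  move=> w /andP[ws ew]; apply: CZ; first by rewrite divr_ge0 ?mulr_ge0 // ltW.
  apply: mem_cone_of; rewrite mem_cat; apply/orP; right.
  by apply/allpairsP; exists (v, w); rewrite /= !mem_filter ev ew.
have -> : x = z + (1 - N / P) *: p + t; last first.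
  apply: (CD) => //; apply: CD => //; apply: CZ => //.
  by rewrite subr_ge0 ler_pdivrMr // mul1r -subr_ge0.
rewrite xE -!addrA; congr (_ + _); rewrite scalerBl scale1r -addrA; congr (_ + _).
apply/eqP; rewrite addrC -subr_eq opprK; apply/eqP.
have -> : t = \sum_(v <- s | 0 < e v) \sum_(w <- s | e w < 0)
   ((c v * (e v)%:~R / P) *: (c w *: real_cV R w)
    + (c w * (- e w)%:~R / P) *: (c v *: real_cV R v)).
  apply: eq_bigr => v _; apply: eq_bigr => w _.
  by apply/matrixP => i j; rewrite !mxE rmorphB !rmorphM rmorphN /=; ring.
rewrite (eq_bigr (fun v => (c v * (e v)%:~R / P) *: q + (N / P) *: (c v *: real_cV R v))); last first.
  move=> v _; rewrite big_split /= -scaler_sumr; congr (_ + _).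
  by rewrite -scaler_suml -mulr_suml.
rewrite big_split /= -scaler_sumr -scaler_suml -mulr_suml divff ?scale1r //.
by rewrite gt_eqF.
Qed.

End ConeLemmas.
Arguments hrep R [n] us _.
Arguments convex_cone_of R [n] s.

Section HRep.
Variables (R : realType) (n : nat).
Implicit Types (us : seq 'rV[int]_n) (x y : 'cV[R]_n) (C : set 'cV[R]_n).

Lemma pair_eq0 (u : 'rV[R]_n) x : (u *m x = 0) <-> ((u *m x) 0 0 = 0).
Proof.
split=> [->|h]; first by rewrite mxE.
by apply/matrixP => i j; rewrite !ord1 h mxE.
Qed.

Lemma hrep_cons u us : hrep R (u :: us) = hrep R us `&` hrep R [:: u].
Proof.
apply/seteqP; split=> x.
  move=> h; split=> w wus; apply: h; rewrite inE; first by rewrite wus orbT.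
  by move: wus; rewrite inE => ->.
move=> [h1 h2] w; rewrite inE => /orP[/eqP ->|]; last exact: h1.
exact/h2/mem_head.
Qed.

Lemma hrep_cat us ws : hrep R (us ++ ws) = hrep R us `&` hrep R ws.
Proof.
apply/seteqP; split=> x.
  by move=> h; split=> w wus; apply: h; rewrite mem_cat wus ?orbT.
by move=> [h1 h2] w; rewrite mem_cat => /orP[]; [exact: h1|exact: h2].
Qed.

Lemma hrep_preimage (A : 'M[int]_n) us :
  [set x | hrep R us (map_mx intr A *m x)] = hrep R [seq u *m A | u <- us].
Proof.
apply/seteqP; split=> x h u.
  by move=> /mapP[w wus ->]; rewrite map_mxM -mulmxA; exact: h.
by move=> uus; rewrite mulmxA -map_mxM; apply/h/map_f.
Qed.

Lemma polyhedral_hrep us : rational_polyhedral (hrep R us).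
Proof.
elim: us => [|u us [s IH]]; last by rewrite hrep_cons IH; exact: cone_of_half.
exists ([seq delta_mx i 0 | i <- enum 'I_n] ++ [seq - delta_mx i 0 | i <- enum 'I_n]).
apply/seteqP; split=> // x _; set s := (_ ++ _).
have [C0 CD CZ] := convex_cone_of R s.
have -> : x = \sum_i (x i 0 *: real_cV R (delta_mx i 0)).
  apply/matrixP => i j; rewrite summxE (bigD1 i) //= big1 => [|k ki].
    by rewrite !mxE !eqxx ord1 mulr1 addr0.
  by rewrite !mxE eq_sym (negbTE ki) mulr0.
apply: convex_cone_sum => [|i _]; first exact: convex_cone_of.
have [x0|x0] := leP 0 (x i 0).
  apply: CZ => //; apply: mem_cone_of; rewrite mem_cat; apply/orP; left.
    by apply/mapP; exists i; rewrite ?mem_enum.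
have -> : x i 0 *: real_cV R (delta_mx i 0) = - x i 0 *: real_cV R (- delta_mx i 0).
  by rewrite /real_cV map_mxN scaleNr scalerN opprK.
apply: CZ; first by rewrite oppr_ge0 ltW.
apply: mem_cone_of; rewrite mem_cat; apply/orP; right.
by apply/mapP; exists i; rewrite ?mem_enum.
Qed.

Lemma relint C us : convex_cone C -> C `<=` hrep R us ->
  exists2 p, C p & forall u, u \in us -> (map_mx intr u *m p) 0 0 = 0 ->
    forall x, C x -> (map_mx intr u *m x) 0 0 = 0.
Proof.
move=> cC; have [C0 CD CZ] := cC.
elim: us => [|u us IH] sC; first by exists 0.
have [|p Cp hp] := IH; first by move=> x /sC; rewrite hrep_cons => -[].
have [[y Cy hy]|hn] := pselect (exists2 y, C y & (map_mx intr u *m y) 0 0 != 0); last first.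
  exists p => // w; rewrite inE => /orP[/eqP -> _ x Cx|]; last exact: hp.
  by apply/eqP/negPn/negP => ux; apply: hn; exists x.
have pos x w : C x -> w \in u :: us -> 0 <= (map_mx intr w *m x) 0 0.
  by move=> /sC; apply.
exists (p + y); first exact: CD.
move=> w wus; rewrite pairD => /eqP.
rewrite paddr_eq0 ?pos // => /andP[/eqP wp /eqP wy].
move: wus; rewrite inE => /orP[/eqP wu|wus]; last exact: hp.
by move: hy; rewrite -wu wy eqxx.
Qed.

Lemma perturb us p x : hrep R us p ->
  hrep R us x ->
  (forall u, u \in us -> (map_mx intr u *m p) 0 0 = 0 ->
     (map_mx intr u *m x) 0 0 = 0) ->
  exists2 e : R, 0 < e & hrep R us (p - e *: x).
Proof.
elim: us => [|u us IH]; first by exists 1.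
rewrite hrep_cons => -[hp up] [hx ux] h.
have {}up := up u (mem_head _ _); have {}ux := ux u (mem_head _ _).
have [|e e0 he] := IH hp hx; first by move=> w wus; apply: h; rewrite inE wus orbT.
have key (d : R) : 0 < d -> d <= e -> hrep R us (p - d *: x).
  move=> d0 de w wus; rewrite pairD -scaleNr pairZ mulNr subr_ge0.
  have := he w wus; rewrite pairD -scaleNr pairZ mulNr subr_ge0.
  by apply: le_trans; apply: ler_wpM2r => //; exact: hx.
have [up0|up0] := eqVneq ((map_mx intr u *m p) 0 0) 0.
  exists e => //; split; first exact: key.
  move=> w; rewrite inE => /eqP ->; rewrite pairD -scaleNr pairZ up0.
  by rewrite h ?mem_head // mulr0 addr0.
have upp : 0 < (map_mx intr u *m p) 0 0 by rewrite lt_def up0.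
pose d := Num.min e ((map_mx intr u *m p) 0 0 / ((map_mx intr u *m x) 0 0 + 1)).
have d0 : 0 < d by rewrite lt_min e0 divr_gt0 // ltr_wpDl.
exists d => //; split; first by apply: key => //; rewrite ge_min lexx.
move=> w; rewrite inE => /eqP ->; rewrite pairD -scaleNr pairZ mulNr subr_ge0.
apply: (@le_trans _ _ (d * ((map_mx intr u *m x) 0 0 + 1))).
  by rewrite ler_pM2l // lerDl.
by rewrite -ler_pdivlMr ?ltr_wpDl // ge_min lexx orbT.
Qed.

Lemma face_of_hrep us p : hrep R us p ->
  face [set x | hrep R us x /\ forall u, u \in us ->
     (map_mx intr u *m p) 0 0 = 0 -> (map_mx intr u *m x) 0 0 = 0] (hrep R us).
Proof.
move=> hp; pose P (u : 'rV[int]_n) := (map_mx intr u *m p) 0 0 == 0 :> R.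
pose w : 'rV[R]_n := \sum_(u <- us | P u) map_mx intr u.
have wE x : (w *m x) 0 0 = \sum_(u <- us | P u) (map_mx intr u *m x) 0 0.
  by rewrite /w mulmx_suml summxE.
exists w.
  move=> x hx; rewrite wE big_seq_cond; apply: sumr_ge0 => u /andP[uus _]; exact: hx.
apply/seteqP; split=> x /= [hx h]; split=> //.
  apply/pair_eq0; rewrite wE big_seq_cond big1 // => u /andP[uus /eqP]; exact: h.
move=> u uus /eqP up; move/pair_eq0: h; rewrite wE big_seq_cond => /eqP.
rewrite psumr_eq0 => [|v /andP[vus _]]; last exact: hx.
by move=> /allP/(_ _ uus); rewrite uus /= /P up => /eqP.
Qed.

End HRep.

Section CommonRefinement.
Variables (R : realType) (n : nat) (A : 'M[int]_n) (S : fan R n).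
Hypothesis S_hrep : forall sigma, cones S sigma -> exists us, sigma = hrep R us.
Hypothesis S_complete : fan_support S = setT.

Definition preim_cone (tau : set 'cV[R]_n) : set 'cV[R]_n :=
  [set x | tau (map_mx intr A *m x)].

Definition common_cones : set (set 'cV[R]_n) :=
  [set st.1 `&` preim_cone st.2 | st in cones S `*` cones S].

Let B : 'M[R]_n := map_mx intr A.

Lemma common_finite : finite_set common_cones.
Proof. by apply: finite_image; apply: finite_setX; exact: fan_finite. Qed.

Lemma common_polyhedral c : common_cones c -> rational_polyhedral c.
Proof.
case=> -[s t] [/= /S_hrep[us ->] /S_hrep[ws ->]] <-.
by rewrite /preim_cone hrep_preimage -hrep_cat; exact: polyhedral_hrep.
Qed.

Lemma common_strongly_convex c : common_cones c -> strongly_convex c.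
Proof.
case=> -[s t] [/= Ss _] <- x [xs _] [nxs _].
exact: (fan_strongly_convex Ss).
Qed.

Lemma common_face c d : common_cones c -> face d c -> common_cones d.
Proof.
case=> -[s t] [/= Ss St] <- [u up ->].
have [us sE] := S_hrep Ss; have [ws tE] := S_hrep St.
pose F := (s `&` preim_cone t) `&` [set x | u *m x = 0].
pose L := us ++ [seq w *m A | w <- ws].
have LE : hrep R L = s `&` preim_cone t.
  by rewrite hrep_cat -hrep_preimage sE tE.
have cF : convex_cone F.
  apply: convex_coneI; first by rewrite -LE; exact: hrep_convex.
  split=> [|x y /= ux uy|a x _ /= ux]; first by rewrite /= mulmx0.
    by rewrite mulmxDr ux uy addr0.
  by rewrite -scalemxAr ux scaler0.
have FL : F `<=` hrep R L by move=> x []; rewrite LE.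
have [p Fp pmax] := relint cF FL.
have [[sp tp] up0] := Fp.
pose s' := [set x | hrep R us x /\ forall u, u \in us ->
     (map_mx intr u *m p) 0 0 = 0 -> (map_mx intr u *m x) 0 0 = 0].
pose t' := [set x | hrep R ws x /\ forall w, w \in ws ->
     (map_mx intr w *m (B *m p)) 0 0 = 0 -> (map_mx intr w *m x) 0 0 = 0].
have Ss' : cones S s'.
  apply: (fan_face Ss); rewrite sE; apply: face_of_hrep; by rewrite -sE.
have St' : cones S t'.
  apply: (fan_face St); rewrite tE; apply: face_of_hrep; by rewrite -tE.
exists (s', t') => //=; apply/seteqP; split=> x.
  move=> [[hs s0] [ht t0]].
  have xL : hrep R L x by rewrite LE sE tE.
  have [|e e0] := perturb (FL _ Fp) xL.
    move=> w; rewrite mem_cat => /orP[|/mapP[v vws ->]]; first exact: s0.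
    by rewrite map_mxM -!mulmxA; exact: t0.
  rewrite LE => peC; rewrite LE in xL; split=> //.
  apply/pair_eq0/eqP; rewrite eq_le up // andbT.
  have := up _ peC; rewrite pairD -scaleNr pairZ (iffLR (pair_eq0 _ _)) //.
  by rewrite add0r mulNr oppr_ge0 pmulr_rle0.
move=> Fx; have [[sx tx] ux] := Fx; split; split.
- by rewrite -sE.
- by move=> w wus wp; apply: pmax => //; rewrite mem_cat wus.
- by rewrite -tE.
- move=> w wws wp; rewrite mulmxA -map_mxM; apply: pmax => //.
    by rewrite mem_cat (map_f (fun w => w *m A) wws) orbT.
  by rewrite map_mxM -mulmxA.
Qed.

Lemma common_cap c d : common_cones c -> common_cones d -> face (c `&` d) c.
Proof.
case=> -[s t] [/= Ss St] <- [[s' t'] [/= Ss' St']] <-.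
have [u up us] := fan_capl Ss Ss'; have [w wp wt] := fan_capl St St'.
have wpB x : preim_cone t x -> 0 <= (w *m B *m x) 0 0.
  by rewrite -mulmxA; exact: wp.
exists (u + w *m B).
  by move=> x [sx tx]; rewrite mulmxDl mxE addr_ge0 ?up ?wpB.
apply/seteqP; split=> x.
  move=> [[sx tx] [sx' tx']]; split=> //=.
  have : (s `&` s') x by []. rewrite us => -[_ /= ux].
  have : (t `&` t') (B *m x) by []. rewrite wt => -[_ /= wx].
  by rewrite mulmxDl ux -mulmxA wx addr0.
move=> [[sx tx] /pair_eq0]; rewrite mulmxDl mxE => /eqP.
rewrite paddr_eq0 ?up ?wpB // => /andP[/eqP/pair_eq0 ux /eqP/pair_eq0 wx].
have : (s `&` s') x by rewrite us.
have : (t `&` t') (B *m x) by rewrite wt; split=> //=; rewrite mulmxA.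
by move=> [? ?] [? ?].
Qed.

Lemma common_capr c d : common_cones c -> common_cones d -> face (c `&` d) d.
Proof. by move=> Cc Cd; rewrite setIC; exact: common_cap. Qed.

Definition common_refinement : fan R n :=
  Fan common_finite common_polyhedral common_strongly_convex common_face
      common_cap common_capr.

Lemma common_refines : refines common_refinement S.
Proof.
split; last by move=> _ [[s t] [/= Ss St]] <-; exists s => // x [].
rewrite S_complete; apply/seteqP; split=> // x _.
have [s Ss sx] : fan_support S x by rewrite S_complete.
have [t St tx] : fan_support S (B *m x) by rewrite S_complete.
by exists (s `&` preim_cone t) => //; exists (s, t).
Qed.

Lemma common_maps_cones_into : maps_cones_into A common_refinement S.
Proof. by move=> _ [[s t] [/= Ss St]] <-; exists t => // x []. Qed.

End CommonRefinement.

Section P1n.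
Variables (R : realType) (n : nat).
Implicit Types (x : 'cV[R]_n) (s : 'I_n -> bool) (I : {set 'I_n}).

Definition signed_basis (b : bool) (i : 'I_n) : 'cV[int]_n :=
  (-1) ^+ b *: delta_mx i 0.

Definition orthant s : set 'cV[R]_n :=
  cone_of R [seq signed_basis (s i) i | i <- enum 'I_n].

Definition P1n_cones : set (set 'cV[R]_n) :=
  [set tau | exists s, face tau (orthant s)].

Let pcone s I : set 'cV[R]_n :=
  [set x | forall i, 0 <= (-1) ^+ s i * x i 0 /\ (i \notin I -> x i 0 = 0)].

Let sgn_eq0 s i (a : R) : ((-1) ^+ s i * a == 0) = (a == 0).
Proof. by rewrite mulf_eq0 signr_eq0. Qed.

Let basisE b i j : real_cV R (signed_basis b i) j 0 = (-1) ^+ b * (j == i)%:R.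
Proof.
rewrite !mxE eqxx andbT rmorphM rmorphXn rmorphN1 /=.
by case: (j == i).
Qed.

Let cone_basis s I :
  cone_of R [seq signed_basis (s i) i | i <- enum I] = pcone s I.
Proof.
apply/seteqP; split.
  apply: cone_of_sub.
    split=> [i|x y hx hy i|a x a0 hx i]; rewrite !mxE ?mulr0 //.
      have [? hI] := hx i; have [? hI'] := hy i.
      by rewrite mulrDr addr_ge0 //; split=> // iI; rewrite hI // hI' // addr0.
    have [? hI] := hx i.
    by rewrite mulrCA mulr_ge0 //; split=> // iI; rewrite hI // mulr0.
  move=> v /mapP[i + ->] j; rewrite mem_enum basisE => iI.
  have [->|_] := eqVneq j i; last by rewrite !mulr0.
  by rewrite iI mulr1 -expr2 sqrr_sign.
move=> x hx.
have -> : x = \sum_(i <- enum I) (((-1) ^+ s i * x i 0) *: real_cV R (signed_basis (s i) i)).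
  rewrite big_enum /=; apply/matrixP => j k; rewrite summxE ord1.
  under eq_bigr do rewrite mxE basisE mulrACA -expr2 sqrr_sign mul1r.
  case: (boolP (j \in I)) => jI.
    rewrite (bigD1 j) //= eqxx mulr1 big1 ?addr0 // => i /andP[_ ij].
    by rewrite eq_sym (negbTE ij) mulr0.
  rewrite big1; first by case: (hx j) => _; apply.
  move=> i iI; case: eqP => [ji|_]; last by rewrite mulr0.
  by rewrite ji iI in jI.
rewrite big_seq; apply: convex_cone_sum => [|i iI]; first exact: convex_cone_of.
have [_ _] := convex_cone_of R [seq signed_basis (s i) i | i <- enum I]; apply.
  by case: (hx i).
by apply: mem_cone_of; apply/mapP; exists i.
Qed.

Let orthant_pcone s : orthant s = pcone s [set: 'I_n]%SET.
Proof.
by rewrite -cone_basis /orthant enum_setT enumT.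
Qed.

Lemma orthantE s : orthant s = [set x | forall i, 0 <= (-1) ^+ s i * x i 0].
Proof.
rewrite orthant_pcone; apply/seteqP; split=> x h i; first by case: (h i).
by split=> //; rewrite inE.
Qed.

Lemma pairE (u : 'rV[R]_n) x : (u *m x) 0 0 = \sum_i u 0 i * x i 0.
Proof. by rewrite mxE. Qed.

Lemma face_pcone s I (d : set 'cV[R]_n) :
  face d (pcone s I) -> exists J, d = pcone s J.
Proof.
move=> [u up ->].
pose J := [set i in I | u 0 i == 0]; exists J.
have up' i : i \in I -> 0 <= u 0 i * (-1) ^+ s i.
  move=> iI.
  have := up ((-1) ^+ s i *: delta_mx i 0); rewrite pairE (bigD1 i) //= big1.
    rewrite !mxE !eqxx mulr1 addr0; apply=> j; rewrite !mxE eqxx andbT.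
    have [->|ji] := eqVneq j i; last by rewrite !mulr0.
    by rewrite mulr1 -expr2 sqrr_sign iI.
  by move=> j ji; rewrite !mxE (negbTE ji) !mulr0.
have term x i : pcone s I x -> 0 <= u 0 i * x i 0.
  move=> /(_ i)[h1 h2]; case: (boolP (i \in I)) => iI; last by rewrite h2 // mulr0.
  have := mulr_ge0 (up' _ iI) h1.
  by rewrite mulrA -(mulrA (u 0 i)) -expr2 sqrr_sign mulr1.
apply/seteqP; split=> x.
  move=> [hx /pair_eq0]; rewrite pairE => /eqP.
  rewrite psumr_eq0 => [/allP h i|i _]; last exact: term.
  have [hi hI] := hx i; split=> //; rewrite inE => niJ.
  have := h i; rewrite mem_index_enum => /(_ isT) /=; rewrite mulf_eq0.
  move=> /orP[u0|/eqP//]; apply: hI; apply: contra niJ => iI; by rewrite iI u0.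
move=> hx.
have hI : pcone s I x.
  move=> i; have [? h] := hx i; split=> // iI; apply: h.
  by rewrite inE (negbTE iI).
split=> //; apply/pair_eq0; rewrite pairE big1 // => i _.
have [_] := hx i; rewrite inE; case: eqP => [->|_]; first by rewrite mul0r.
by rewrite andbF => ->; rewrite ?mulr0.
Qed.

Lemma pcone_face s (I J : {set 'I_n}) : J \subset I -> face (pcone s J) (pcone s I).
Proof.
move=> JI; pose u : 'rV[R]_n := \row_i (if i \in J then 0 else (-1) ^+ s i).
have uE x : (u *m x) 0 0 = \sum_(i | i \notin J) (-1) ^+ s i * x i 0.
  rewrite pairE (bigID (mem J)) /= big1 ?add0r => [|i iJ].
    by apply: eq_bigr => i iJ; rewrite mxE (negbTE iJ).
  by rewrite mxE iJ mul0r.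
exists u; first by move=> x hx; rewrite uE sumr_ge0 // => i _; case: (hx i).
apply/seteqP; split=> x.
  move=> hx; split.
    move=> i; have [? h] := hx i; split=> // iI; apply: h; apply: contra iI.
    exact: (fintype.subsetP JI).
  by apply/pair_eq0; rewrite uE big1 // => i /(proj2 (hx i)) ->; rewrite mulr0.
move=> [hx /pair_eq0]; rewrite uE => /eqP.
rewrite psumr_eq0 => [/allP h i|i _]; last by case: (hx i).
split; first by case: (hx i).
move=> iJ; have := h i; rewrite mem_index_enum => /(_ isT); rewrite iJ /=.
by rewrite sgn_eq0 => /eqP.
Qed.

Lemma P1n_conesP tau : P1n_cones tau <-> exists s I, tau = pcone s I.
Proof.
split=> [[s]|[s [I ->]]].
  by rewrite orthant_pcone => /face_pcone[J ->]; exists s, J.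
by exists s; rewrite orthant_pcone; apply: pcone_face; exact: finset.subsetT.
Qed.

Lemma P1n_finite : finite_set P1n_cones.
Proof.
pose T := ({ffun 'I_n -> bool} * {set 'I_n})%type.
apply: (@sub_finite_set _ _ ((fun t : T => pcone t.1 t.2) @` setT)).
  move=> _ /P1n_conesP[s [I ->]]; exists ([ffun i => s i], I) => //=.
  by congr (pcone _ I); apply/funext => i; rewrite ffunE.
exact/finite_image/finite_finset.
Qed.

Lemma P1n_hrep sigma : P1n_cones sigma -> exists us, sigma = hrep R us.
Proof.
move=> /P1n_conesP[s [I ->]].
pose e i : 'rV[int]_n := (-1) ^+ s i *: delta_mx 0 i.
have eE i x : (map_mx intr (e i) *m x) 0 0 = (-1) ^+ s i * x i 0.
  rewrite pairE (bigD1 i) //= big1 => [|j ji].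
    by rewrite !mxE !eqxx mulr1 addr0 rmorphXn rmorphN1.
  by rewrite !mxE (negbTE ji) mulr0 rmorph0 mul0r.
exists ([seq e i | i <- enum 'I_n] ++ [seq - e i | i <- enum (~: I)]).
apply/seteqP; split=> x hx.
  move=> u; rewrite mem_cat => /orP[/mapP[i _ ->]|/mapP[i]].
    by rewrite eE; case: (hx i).
  rewrite mem_enum inE => /(proj2 (hx i)) xi ->.
  by rewrite map_mxN mulNmx mxE eE xi mulr0 oppr0.
move=> i; have h1 : 0 <= (-1) ^+ s i * x i 0.
  by rewrite -eE; apply: hx; rewrite mem_cat; apply/orP; left;
    apply/mapP; exists i; rewrite ?mem_enum.
split=> // iI; apply/eqP; rewrite -(sgn_eq0 s i) eq_le h1 andbT -oppr_ge0.
have : 0 <= (map_mx intr (- e i) *m x) 0 0.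
  apply: hx; rewrite mem_cat; apply/orP; right.
  by apply/mapP; exists i; rewrite ?mem_enum ?inE.
by rewrite map_mxN mulNmx mxE eE.
Qed.

Lemma P1n_polyhedral sigma : P1n_cones sigma -> rational_polyhedral sigma.
Proof. by move=> /P1n_hrep[us ->]; exact: polyhedral_hrep. Qed.

Lemma P1n_strongly_convex sigma : P1n_cones sigma -> strongly_convex sigma.
Proof.
move=> /P1n_conesP[s [I ->]] x hx hnx; apply/matrixP => i j.
rewrite ord1 mxE; apply/eqP; rewrite -(sgn_eq0 s i) eq_le.
have [-> _] := hx i; have [] := hnx i.
by rewrite mxE mulrN oppr_ge0 => ->.
Qed.

Lemma P1n_face sigma tau : P1n_cones sigma -> face tau sigma -> P1n_cones tau.
Proof.
move=> /P1n_conesP[s [I ->]] /face_pcone[J ->]; apply/P1n_conesP.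
by exists s, J.
Qed.

Lemma P1n_capl sigma tau : P1n_cones sigma -> P1n_cones tau ->
  face (sigma `&` tau) sigma.
Proof.
move=> /P1n_conesP[s [I ->]] /P1n_conesP[s' [I' ->]].
suff -> : pcone s I `&` pcone s' I' =
   pcone s [set i in I :&: I' | s i == s' i]%SET.
  by apply: pcone_face; apply/fintype.subsetP => i; rewrite !inE -andbA => /andP[].
apply/seteqP; split=> x.
  move=> [hx hx'] i; have [h1 h2] := hx i; have [h1' h2'] := hx' i; split=> //.
  rewrite !inE !negb_and -orbA => /or3P[//|//|ss'].
  apply/eqP; rewrite -(sgn_eq0 s i) eq_le h1 andbT.
  have sE : (-1) ^+ s i = - (-1) ^+ s' i :> R.
    by move: ss'; case: (s i); case: (s' i); rewrite ?opprK.
  by rewrite sE mulNr oppr_le0.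
move=> hx; split=> i; have [h1 h2] := hx i.
  by split=> // iI; apply: h2; rewrite !inE (negbTE iI).
split=> [|iI]; last by apply: h2; rewrite !inE (negbTE iI) andbF.
case: (eqVneq (s i) (s' i)) => [<- //|ss].
by rewrite h2 ?mulr0 // !inE (negbTE ss) andbF.
Qed.

Lemma P1n_capr sigma tau : P1n_cones sigma -> P1n_cones tau ->
  face (sigma `&` tau) tau.
Proof. by move=> h1 h2; rewrite setIC; exact: P1n_capl. Qed.

(* The fan of (P^1)^n. *)
Definition P1n : fan R n :=
  Fan P1n_finite P1n_polyhedral P1n_strongly_convex P1n_face P1n_capl P1n_capr.

Lemma P1n_complete : fan_support P1n = setT.
Proof.
apply/seteqP; split=> // x _; exists (orthant (fun i => x i 0 < 0)).
  apply/P1n_conesP; exists (fun i => x i 0 < 0), [set: 'I_n]%SET.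
  exact: orthant_pcone.
rewrite orthantE => i; case: ltP => h; last by rewrite mul1r.
by rewrite mulN1r oppr_ge0 ltW.
Qed.

Lemma P1n_generated sigma : P1n_cones sigma -> exists s I,
  sigma = cone_of R [seq signed_basis (s i) i | i <- enum I].
Proof. by move=> /P1n_conesP[s [I ->]]; exists s, I; rewrite cone_basis. Qed.

Lemma signed_basis_primitive b i : primitive (signed_basis b i).
Proof.
move=> d /(_ i); rewrite !mxE eqxx mulr1 abszX => /=.
by rewrite exp1n dvdn1 => /eqP.
Qed.

Lemma signed_basis_cone b i : P1n_cones (cone_of R [:: signed_basis b i]).
Proof.
apply/P1n_conesP; exists (fun=> b), [set i]%SET.
by rewrite -cone_basis enum_set1.
Qed.

Lemma P1n_rays v : primitive v -> P1n_cones (cone_of R [:: v]) ->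
  exists b i, v = signed_basis b i.
Proof.
move=> pv /P1n_conesP[s [J vJ]].
have [i vi0] : exists i, v i 0 != 0.
  apply: contrapT => /forallNP h; suff : 2%N = 1%N by [].
  by apply: pv => i; have /negP/negPn/eqP -> := h i.
have vC : pcone s J (real_cV R v) by rewrite -vJ; apply: mem_cone_of; exact: mem_head.
have iJ : i \in J.
  apply: contraNT vi0 => /(proj2 (vC i)) /eqP; rewrite mxE intr_eq0.
  by [].
have : cone_of R [:: v] (real_cV R (signed_basis (s i) i)).
  rewrite vJ -cone_basis; apply: mem_cone_of; apply/mapP; exists i => //.
  by rewrite mem_enum.
case=> c c0; rewrite big_seq1 => cE.
have cv j : (-1) ^+ s i * (j == i)%:R = c v * (v j 0)%:~R.
  by rewrite -basisE cE !mxE.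
have cn0 : c v != 0.
  apply/eqP => h; have /eqP := cv i; rewrite h mul0r eqxx mulr1.
  by rewrite signr_eq0.
have vj j : j != i -> v j 0 = 0.
  move=> ji; have /esym/eqP := cv j; rewrite (negbTE ji) mulr0 mulf_eq0.
  by rewrite (negbTE cn0) /= intr_eq0 => /eqP.
have vi1 : `|v i ord0|%N = 1%N.
  apply: pv => j; have [->|ji] := eqVneq j i; first exact: dvdnn.
  by rewrite (vj _ ji); exact: dvdn0.
exists (v i 0 < 0), i; apply/matrixP => j k; rewrite ord1 !mxE eqxx andbT.
have [->|ji] := eqVneq j i; last by rewrite vj // mulr0.
have {}vi1 : absz (v i 0) = 1%N by exact: vi1.
by rewrite mulr1; case: ltP => h; rewrite ?expr0 ?expr1; lia.
Qed.

End P1n.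

Section Divisors.
Variables (R : realType) (n : nat).
Implicit Types (S : fan R n).

(* Q-divisors [\sum_r D r * D_r] supported on the torus-invariant prime
   divisors [D_r] of X(S). *)
Definition WDiv S := ray S -> rat.
HB.instance Definition _ S := GRing.Lmodule.copy (WDiv S) (ray S -> rat^o).

(* The order of the character chi^m along [D_r] is <m, v_r>, where [v_r] is the
   primitive generator of [r]; this is extended to m in M_Q. *)
Definition pairing (m : 'rV[rat]_n) (v : 'cV[int]_n) : rat :=
  (m *m map_mx intr v) 0 0.

(* [D] restricted to the affine chart U_sigma is the divisor of chi^m. *)
Definition local_equation S (D : WDiv S) (sigma : set 'cV[R]_n)
    (m : 'rV[rat]_n) :=
  forall r : ray S, sigma (real_cV R (val r)) -> D r = pairing m (val r).

(* Since [S] is finite, clearing the denominators of the m in M_Q shows that this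
   holds iff a positive integer multiple of [D] is Cartier, that is, has a local
   equation with m in M = Z^n on every chart. *)
Definition QCartier S (D : WDiv S) :=
  forall sigma, cones S sigma -> exists m, local_equation D sigma m.

Definition QCartier_pred S : {pred WDiv S} := fun D => `[< QCartier D >].

Lemma pairingB m m' v : pairing (m - m') v = pairing m v - pairing m' v.
Proof. by rewrite /pairing mulmxBl !mxE. Qed.

Lemma pairingZ a m v : pairing (a *: m) v = a * pairing m v.
Proof. by rewrite /pairing -scalemxAl mxE. Qed.

Lemma pairingD m m' v : pairing (m + m') v = pairing m v + pairing m' v.
Proof. by rewrite /pairing mulmxDl !mxE. Qed.

Lemma pairing0 v : pairing 0 v = 0.
Proof. by rewrite /pairing mul0mx mxE. Qed.

Lemma QCartier_submod S : submod_closed (@QCartier_pred S).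
Proof.
split=> [|a D D' /asboolP cD /asboolP cD']; apply/asboolP => sigma Ss.
  by exists 0 => r _; rewrite pairing0.
have [m hm] := cD _ Ss; have [m' hm'] := cD' _ Ss.
by exists (a *: m + m') => r hr; rewrite pairingD pairingZ -hm // -hm'.
Qed.
HB.instance Definition _ S :=
  GRing.isSubmodClosed.Build rat (WDiv S) (@QCartier_pred S) (@QCartier_submod S).

(* CDiv_T(X(S))_Q *)
Record CDiv S := MkCDiv {
  cdiv_val :> WDiv S;
  cdivP : cdiv_val \in @QCartier_pred S
}.
HB.instance Definition _ S := [isSub for @cdiv_val S].
HB.instance Definition _ S := [Choice of CDiv S by <:].
HB.instance Definition _ S := [SubChoice_isSubLmodule of CDiv S by <:].

End Divisors.

(* f_A on the torus (F^* )^n, and its action on characters. *)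
Section MonomialMap.
Variables (F : fieldType) (n : nat).
Implicit Types (A B : 'M[int]_n) (x : 'cV[F]_n).

Definition monomial_map A x : 'cV[F]_n :=
  \col_i \prod_j (x j 0) ^ (A i j).

Definition character (m : 'rV[int]_n) x : F := \prod_j (x j 0) ^ (m 0 j).

Lemma character_monomial_map A m x : (forall j, x j 0 != 0) ->
  character m (monomial_map A x) = character (m *m A) x.
Proof.
move=> x0; rewrite /character.
under eq_bigr => i _.
  rewrite mxE (big_morph (fun y : F => y ^ (m 0 i)) (fun a b => expfzMl a b _) (@exp1rz _ _)).
  over.
rewrite exchange_big; apply: eq_bigr => j _ /=; rewrite mxE.
have xj : x j 0 \is a GRing.unit by rewrite unitfE.
rewrite (big_morph (fun e : int => x j 0 ^ e) (fun a b => expfzDr a b (x0 j)) (expr0z _)).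
by apply: eq_bigr => i _; rewrite [m _ _ * _]mulrC exprz_exp.
Qed.

Lemma monomial_map_comp A B x : (forall j, x j 0 != 0) ->
  monomial_map A (monomial_map B x) = monomial_map (A *m B) x.
Proof.
move=> x0; apply/matrixP => i k; rewrite ord1 !mxE.
have := character_monomial_map B (row i A) x0.
rewrite /character; under eq_bigr do rewrite [row _ _ _ _]mxE.
by move=> ->; apply: eq_bigr => j _; rewrite -row_mul mxE.
Qed.

Lemma iter_monomial_map A k x : (forall j, x j 0 != 0) ->
  iter k (monomial_map A) x = monomial_map (A ^+ k) x.
Proof.
move=> x0; elim: k => [|k /= ->]; last by rewrite exprS monomial_map_comp.
apply/matrixP => i j; rewrite ord1 mxE (bigD1 i) //= big1 => [|l li].
  by rewrite expr0 mxE eqxx mulr1 expr1z.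
by rewrite expr0 mxE eq_sym (negbTE li) expr0z.
Qed.

End MonomialMap.

Section ToricMaps.
Variables (R : realType) (n : nat).
Implicit Types (S : fan R n).

Definition generated_by_rays S := forall sigma, cones S sigma ->
  exists s : seq (ray S), sigma = cone_of R (map val s).

Lemma pairing_cone (m : 'rV[rat]_n) (v : 'cV[int]_n) :
  ratr (pairing m v) = (map_mx ratr m *m real_cV R v) 0 0.
Proof.
rewrite /pairing !mxE rmorph_sum; apply: eq_bigr => i _ /=.
by rewrite !mxE rmorphM /= ratr_int.
Qed.

(* Local equations on two charts differ by a unit on the intersection. *)
Lemma local_equation_uniq S (D : WDiv S) sigma sigma' m m' v :
  generated_by_rays S -> cones S sigma -> cones S sigma' ->
  local_equation D sigma m -> local_equation D sigma' m' ->
  sigma (real_cV R v) -> sigma' (real_cV R v) -> pairing m v = pairing m' v.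
Proof.
move=> gen Ss Ss' hm hm' sv sv'.
have [s sE] := gen _ (fan_face Ss (fan_capl Ss Ss')).
apply: (fmorph_inj (@ratr R)); rewrite /= !pairing_cone.
have [c c0 ->] : cone_of R (map val s) (real_cV R v) by rewrite -sE.
rewrite !pair_sum big_map [RHS]big_map big_seq [RHS]big_seq; apply: eq_bigr => r rs.
have [sr sr'] : (sigma `&` sigma') (real_cV R (val r)).
  by rewrite sE; apply/mem_cone_of/map_f.
by rewrite !pairZ -!pairing_cone -hm // -hm'.
Qed.

Section Pullback.
Variables (A : 'M[int]_n) (S' S : fan R n) (hA : maps_cones_into A S' S).

Definition target_cone (r : ray S') :
  {sigma | cones S sigma & forall x, cone_of R [:: val r] x ->
                             sigma (map_mx intr A *m x)} :=
  cid2 (hA (ray_cone r)).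

Definition local_data (D : CDiv S) sigma (Ss : cones S sigma) : 'rV[rat]_n :=
  sval (cid (asboolP _ (cdivP D) sigma Ss)).

(* The toric map phi : X(S') -> X(S) induced by [A] satisfies
   phi^* chi^m = chi^(m A) (see [character_monomial_map]), so phi^* D has local equation chi^(m A) on the
   charts mapped into a chart on which [D] has local equation chi^m. *)
Definition toric_pullback (D : CDiv S) : WDiv S' := fun r =>
  pairing (local_data D (s2valP (target_cone r)) *m map_mx intr A) (val r).

Lemma pairingA m v : pairing (m *m map_mx intr A) v = pairing m (A *m v).
Proof. by rewrite /pairing map_mxM mulmxA. Qed.

Lemma real_cVA v : real_cV R (A *m v) = map_mx intr A *m real_cV R v.
Proof. exact: map_mxM. Qed.

Lemma toric_pullbackE (D : CDiv S) (r : ray S') sigma m :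
  generated_by_rays S -> cones S sigma -> local_equation D sigma m ->
  sigma (map_mx intr A *m real_cV R (val r)) ->
  toric_pullback D r = pairing (m *m map_mx intr A) (val r).
Proof.
move=> gen Ss hm sr; rewrite /toric_pullback !pairingA.
case: (target_cone r) => tau St hr /=.
apply: (local_equation_uniq gen St Ss _ hm); rewrite ?real_cVA //.
  by rewrite /local_data; case: cid.
by apply/hr/mem_cone_of/mem_head.
Qed.

Lemma toric_pullback_local_equation (D : CDiv S) sigma' sigma m :
  generated_by_rays S -> cones S sigma ->
  (forall x, sigma' x -> sigma (map_mx intr A *m x)) ->
  local_equation D sigma m ->
  local_equation (toric_pullback D) sigma' (m *m map_mx intr A).
Proof.
move=> gen Ss h hm r sr; exact: toric_pullbackE (h _ sr).
Qed.

End Pullback.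

(* Push forward of divisors by the birational morphism X(S') -> X(S) induced by
   the identity, for [S'] a refinement of [S]: the divisors [D_r] with [r] not a
   ray of [S] are contracted. *)
Definition pushforward S' S (D : WDiv S') : WDiv S := fun r =>
  if insub (val r) is Some r' then D r' else 0.

Lemma refines_ray S' S (r : ray S) : refines S' S ->
  exists r' : ray S', val r' = val r.
Proof.
move=> [hs hr]; have [pr Sr] := asboolP _ (valP r).
set rho := cone_of R [:: val r] in Sr.
have rv : rho (real_cV R (val r)) by apply/mem_cone_of/mem_head.
have [s' Ss' s'v] : fan_support S' (real_cV R (val r)).
  by rewrite hs; exists rho.
have [s Ss ss'] := hr _ Ss'.
have rs : rho `&` s = rho.
  apply/setIidPl; apply: cone_of_sub.
    have [us ->] := fan_polyhedral Ss; exact: convex_cone_of.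
  by move=> v; rewrite inE => /eqP ->; exact: ss'.
have [u up] := fan_capr Sr Ss; rewrite rs => rhoE.
have rhoS' : rho = s' `&` [set x | u *m x = 0].
  apply/seteqP; split=> x; last by rewrite rhoE => -[/ss' ? ?].
  move: x; apply: cone_of_sub.
    apply: convex_coneI.
      have [us ->] := fan_polyhedral Ss'; exact: convex_cone_of.
    split=> [|x y /= ux uy|a x _ /= ux]; first by rewrite /= mulmx0.
      by rewrite mulmxDr ux uy addr0.
    by rewrite -scalemxAr ux scaler0.
  move=> v; rewrite inE => /eqP ->; split=> //.
  by move: rv; rewrite rhoE => -[].
have S'rho : cones S' rho.
  by apply: (fan_face Ss'); exists u => // x /ss'; exact: up.
have vP : `[< primitive (val r) /\ cones S' (cone_of R [:: val r]) >] by apply/asboolP.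
by exists (Sub (val r) vP); rewrite SubK.
Qed.

Lemma pushforwardE S' S (D : WDiv S') (r : ray S) (r' : ray S') :
  val r' = val r -> pushforward D r = D r'.
Proof. by move=> rr'; rewrite /pushforward -rr' valK. Qed.

End ToricMaps.
Arguments pushforward {R n S'} S D _.

Section Picard.
Variables (R : realType) (n : nat) (S : fan R n).

(* [D] is the divisor of chi^m for some m in M_Q. *)
Definition principal (D : CDiv S) :=
  exists m, forall r : ray S, cdiv_val D r = pairing m (val r).

Definition principal_pred : {pred CDiv S} := fun D => `[< principal D >].

Lemma principal_zmod : zmod_closed principal_pred.
Proof.
split; first by apply/asboolP; exists 0 => r; rewrite pairing0.
move=> D D' /asboolP[m hm] /asboolP[m' hm']; apply/asboolP; exists (m - m') => r.
by rewrite pairingB -hm -hm'.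
Qed.
HB.instance Definition _ :=
  GRing.isZmodClosed.Build (CDiv S) principal_pred principal_zmod.

(* Every divisor on X(S) is linearly equivalent to a torus-invariant one, and
   D, D' in CDiv_T have the same class iff D - D' = div(chi^m): Pic(X(S)) is
   CDiv_T / M, and Pic(X(S))_Q is the quotient below. *)
Definition Pic := Quotient.quot principal_pred.
HB.instance Definition _ := GRing.Zmodule.on Pic.
HB.instance Definition _ := EqQuotient.on Pic.

End Picard.

Section MonomialMaps.
Variables (R : realType) (n : nat).
Local Notation X := (P1n R n).

Definition P1n_ray (b : bool) (i : 'I_n) : ray X :=
  exist _ (signed_basis b i)
    (introT (asboolP _) (conj (@signed_basis_primitive n b i)
                              (@signed_basis_cone R n b i))).

Lemma P1n_rayP (r : ray X) : exists b i, r = P1n_ray b i.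
Proof.
have [pr Sr] := asboolP _ (valP r); have [b [i rE]] := P1n_rays pr Sr.
by exists b, i; apply: val_inj.
Qed.

Lemma P1n_generated_by_rays : generated_by_rays X.
Proof.
move=> sigma /P1n_generated[s [I ->]].
by exists [seq P1n_ray (s i) i | i <- enum I]; rewrite -map_comp.
Qed.

Lemma P1n_QCartier (D : WDiv X) : D \in @QCartier_pred R n X.
Proof.
apply/asboolP => sigma [s [u _ ->]].
exists (\row_i ((-1) ^+ s i * D (P1n_ray (s i) i))) => r [or _].
have [b [i rE]] := P1n_rayP r.
have bs : b = s i.
  move: or; rewrite orthantE rE => /(_ i) /=; rewrite !mxE !eqxx mulr1.
  by rewrite rmorphXn rmorphN1 /=; case: (s i); case: b {rE} => //=;
    rewrite ?expr1 ?expr0 ?mulr1 ?mul1r => h; exfalso; lra.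
rewrite rE bs /pairing mxE (bigD1 i) //= big1 => [|j ji].
  rewrite !mxE !eqxx mulr1 addr0 rmorphXn rmorphN1 /= mulrAC -expr2.
  by rewrite sqrr_sign mul1r.
by rewrite !mxE (negbTE ji) mulr0 rmorph0 mulr0.
Qed.

Definition pullback_along (A : 'M[int]_n) (S' : fan R n)
    (hA : maps_cones_into A S' X) (D : CDiv X) : CDiv X :=
  MkCDiv (P1n_QCartier (pushforward X (toric_pullback hA D))).

Lemma pullback_alongE A S' (hA : maps_cones_into A S' X) (D : CDiv X) (r : ray X) sigma m :
  refines S' X -> cones X sigma -> local_equation D sigma m ->
  sigma (map_mx intr A *m real_cV R (val r)) ->
  cdiv_val (pullback_along hA D) r = pairing (m *m map_mx intr A) (val r).
Proof.
move=> href Ss hm sr; have [r' rr'] := refines_ray r href.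
rewrite /= (pushforwardE _ rr') -rr'.
by apply: toric_pullbackE hm _ => //; [exact: P1n_generated_by_rays|rewrite rr'].
Qed.

Lemma P1n_local_equation (D : CDiv X) (x : 'cV[R]_n) : exists sigma m,
  [/\ cones X sigma, local_equation D sigma m & sigma x].
Proof.
have [s Ss sx] : fan_support X x by rewrite P1n_complete.
by have [m hm] := asboolP _ (cdivP D) s Ss; exists s, m.
Qed.

Lemma pullback_along_indep A S1 S2
    (h1 : maps_cones_into A S1 X) (h2 : maps_cones_into A S2 X) :
  refines S1 X -> refines S2 X -> pullback_along h1 =1 pullback_along h2.
Proof.
move=> r1 r2 D; apply: val_inj; apply/funext => r.
have [s [m [Ss hm sr]]] := P1n_local_equation D (map_mx intr A *m real_cV R (val r)).
exact: etrans (pullback_alongE h1 r1 Ss hm sr)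
              (esym (pullback_alongE h2 r2 Ss hm sr)).
Qed.

Definition adapted_refinement (A : 'M[int]_n) : fan R n :=
  @common_refinement R n A X (@P1n_hrep R n).

Lemma adapted_refines A : refines (adapted_refinement A) X.
Proof. exact/common_refines/P1n_complete. Qed.

Lemma adapted_maps_cones_into A : maps_cones_into A (adapted_refinement A) X.
Proof. exact: common_maps_cones_into. Qed.

(* f_A^* on CDiv_T(X)_Q, computed on one adapted refinement; any other one gives
   the same map by [pullback_along_indep]. *)
Definition pullback (A : 'M[int]_n) : CDiv X -> CDiv X :=
  pullback_along (@adapted_maps_cones_into A).

Lemma pullbackE A (D : CDiv X) (r : ray X) sigma m :
  cones X sigma -> local_equation D sigma m ->
  sigma (map_mx intr A *m real_cV R (val r)) ->
  cdiv_val (pullback A D) r = pairing (m *m map_mx intr A) (val r).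
Proof. exact/pullback_alongE/adapted_refines. Qed.

Lemma pullback_linear A : linear (pullback A).
Proof.
move=> a D E; apply: val_inj; apply/funext => r; set y := map_mx intr A *m real_cV R (val r).
have [s Ss sy] : fan_support X y by rewrite P1n_complete.
have [m hm] := asboolP _ (cdivP D) s Ss; have [p hp] := asboolP _ (cdivP E) s Ss.
have hDE : local_equation (a *: D + E) s (a *: m + p).
  by move=> q sq; rewrite pairingD pairingZ -hm // -hp.
rewrite -[LHS]/(cdiv_val (pullback A (a *: D + E)) r) (pullbackE Ss hDE sy).
rewrite -[RHS]/(a * cdiv_val (pullback A D) r + cdiv_val (pullback A E) r).
rewrite (pullbackE Ss hm sy) (pullbackE Ss hp sy).
by rewrite mulmxDl pairingD -scalemxAl pairingZ.
Qed.
HB.instance Definition _ A :=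
  GRing.isLinear.Build rat (CDiv X) (CDiv X) *:%R (pullback A) (@pullback_linear A).

Lemma pullback_principal A D : principal D -> principal (pullback A D).
Proof.
move=> [m hm]; exists (m *m map_mx intr A) => r.
have [s [_ [Ss _ sr]]] := P1n_local_equation D (map_mx intr A *m real_cV R (val r)).
by apply: pullbackE Ss _ sr => q _; exact: hm.
Qed.

(* f_A^* on Pic(X)_Q, computed on a representative; [pic_pullback_pi] shows that
   the choice does not matter. *)
Definition pic_pullback (A : 'M[int]_n) (c : Pic X) : Pic X :=
  (\pi_(Pic X) (pullback A (repr c)))%qT.

Lemma pic_pullback_pi A D :
  pic_pullback A (\pi_(Pic X) D)%qT = (\pi_(Pic X) (pullback A D))%qT.
Proof.
have : repr (\pi_(Pic X) D)%qT - D \in @principal_pred R n X.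
  by rewrite Quotient.idealrBE reprK.
move=> /asboolP/(pullback_principal A); rewrite linearB => hD.
by apply/eqP; rewrite -Quotient.idealrBE; apply/asboolP.
Qed.

(* f_A^k = f_(A^k), see [iter_monomial_map]. *)
Definition strongly_algebraically_stable (A : 'M[int]_n) :=
  forall k : nat, (0 < k)%N -> pullback (A ^+ k) =1 iter k (pullback A).

Definition algebraically_stable (A : 'M[int]_n) :=
  forall k : nat, (0 < k)%N -> pic_pullback (A ^+ k) =1 iter k (pic_pullback A).

End MonomialMaps.

(* Main.v *)
Require Import Defs.
From mathcomp Require Import all_boot all_order all_algebra.
From mathcomp Require Import all_classical reals.

Import Order.TTheory GRing.Theory Num.Theory.

Local Open Scope ring_scope.

(** Pulling back can fail to be functorial when a ray is sent by the first map into
    the interior of a cone that the second map does not send into a single cone.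
    A non-negative matrix avoids this: it preserves the positive orthant and the
    negative orthant of the fan of [(P^1)^n], and every ray [b e_i] lies in one of
    these two, according to its sign [b].  On each of the two orthants a divisor
    is given by one linear function, whose coefficients are its multiplicities
    along the rays of that sign.  Hence [f_A^*] acts separately on the divisors
    [D_(b e_j)] with [b] positive and on those with [b] negative, and in both
    blocks it is the matrix [A^T] ([pullback_nonneg]).  As products of
    non-negative matrices are non-negative and transposition reverses products,
    pulling back is contravariantly multiplicative on non-negative matrices
    ([pullback_mulmx]), which gives strong stability.  Stability on the Picard
    group follows because it is a quotient of the group of invariant divisors and
    [f_A^*] descends to it ([strongly_stable_stable]). *)

Section NonnegativeMonomialMaps.
Context {R : realType} {n : nat}.
Implicit Types (A B : 'M[int]_n) (D : CDiv (P1n R n)).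

Definition nonneg_mx A := forall i j : 'I_n, 0 <= A i j.

Lemma nonneg_mx1 : nonneg_mx 1%:M.
Proof. by move=> i j; rewrite mxE; case: (i == j). Qed.

Lemma nonneg_mulmx A B : nonneg_mx A -> nonneg_mx B -> nonneg_mx (A *m B).
Proof. by move=> A0 B0 i j; rewrite mxE sumr_ge0 // => k _; rewrite mulr_ge0. Qed.

Lemma nonneg_mxX A k : nonneg_mx A -> nonneg_mx (A ^+ k).
Proof.
move=> A0; elim: k => [|k IHk]; first exact: nonneg_mx1.
by rewrite exprS; exact: nonneg_mulmx.
Qed.

Lemma orthant_cone (s : 'I_n -> bool) : cones (P1n R n) (@orthant R n s).
Proof.
exists s; exists 0; first by move=> x _; rewrite mul0mx mxE.
by apply/esym/setIidPl => x _ /=; rewrite mul0mx.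
Qed.

(** The only rays in the orthant are its generators [s_j e_j], which form a basis,
    so the values of [D] on them can be prescribed freely; the coordinate on [e_j]
    is the value on [s_j e_j] corrected by the sign. *)
Lemma orthant_local_equation D (s : 'I_n -> bool) :
  local_equation D (@orthant R n s)
    (\row_j ((-1) ^+ s j * cdiv_val D (P1n_ray R (s j) j))).
Proof.
move=> r; have [b [i ->]] := P1n_rayP r.
rewrite orthantE => /(_ i); rewrite /= !mxE !eqxx mulr1 rmorphXn rmorphN1 => bs.
have {}bs : b = s i.
  case: b (s i) bs => [] [] //=; rewrite !(expr0, expr1) ?mul1r ?mulr1.
    by rewrite oppr_ge0 ler10.
  by rewrite oppr_ge0 ler10.
rewrite bs /pairing mxE (bigD1 i) //= big1 => [|j ji].
  by rewrite !mxE !eqxx mulr1 addr0 rmorphXn rmorphN1 mulrAC -expr2 sqrr_sign mul1r.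
by rewrite !mxE (negbTE ji) mulr0 rmorph0 mulr0.
Qed.

(** The vector [A (b e_i)] is [b] times column [i] of [A], which lies in the
    orthant of constant sign [b]; there [D] has the local equation of
    [orthant_local_equation], in which the sign cancels. *)
Lemma pullback_nonneg A D b i : nonneg_mx A ->
  cdiv_val (pullback A D) (P1n_ray R b i) =
    \sum_j (A j i)%:~R * cdiv_val D (P1n_ray R b j).
Proof.
move=> A0.
have colE j : (A *m signed_basis b i) j 0 = (-1) ^+ b * A j i.
  by rewrite -scalemxAr -colE !mxE.
rewrite (pullbackE (orthant_cone (fun=> b)) (orthant_local_equation D _)) /=.
  rewrite pairingA /pairing mxE; apply: eq_bigr => j _.
  rewrite [map_mx _ _ _ _]mxE colE mxE rmorphM rmorphXn rmorphN1.
  by rewrite mulrACA -expr2 sqrr_sign mul1r mulrC.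
rewrite orthantE => j; rewrite -real_cVA mxE colE rmorphM rmorphXn rmorphN1.
by rewrite mulrA -expr2 sqrr_sign mul1r ler0z.
Qed.

Lemma cdiv_eq D D' :
  (forall b i, cdiv_val D (P1n_ray R b i) = cdiv_val D' (P1n_ray R b i)) -> D = D'.
Proof.
move=> DD'; apply: val_inj; apply/funext => r.
by have [b [i ->]] := P1n_rayP r; exact: DD'.
Qed.

Lemma pullback1 D : pullback 1%:M D = D.
Proof.
apply: cdiv_eq => b i; rewrite (pullback_nonneg _ _ _ _ nonneg_mx1) (bigD1 i) //=.
rewrite big1 => [|j ji]; first by rewrite mxE eqxx mul1r addr0.
by rewrite mxE (negbTE ji) mul0r.
Qed.

(** Each of the three pull backs acts by a transposed matrix, and [A *m B] is
    again non-negative, so this is [(A B)^T = B^T A^T]. *)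
Lemma pullback_mulmx A B D : nonneg_mx A -> nonneg_mx B ->
  pullback (A *m B) D = pullback B (pullback A D).
Proof.
move=> A0 B0; apply: cdiv_eq => b i.
rewrite (pullback_nonneg _ _ _ _ (nonneg_mulmx _ _ A0 B0)) pullback_nonneg //.
under [RHS]eq_bigr do rewrite pullback_nonneg // mulr_sumr.
rewrite exchange_big; apply: eq_bigr => j _ /=.
rewrite mxE rmorph_sum mulr_suml; apply: eq_bigr => k _.
by rewrite rmorphM mulrAC mulrC.
Qed.

Lemma nonneg_strongly_stable A :
  nonneg_mx A -> strongly_algebraically_stable R A.
Proof.
move=> A0 k _ D; elim: k => [|k IHk] /=; first exact: pullback1.
by rewrite exprSr pullback_mulmx ?IHk //; exact: nonneg_mxX.
Qed.

(** The class of [D] is pulled back to the class of the pull back of [D], so an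
    identity between iterates on divisors passes to classes. *)
Lemma strongly_stable_stable A :
  strongly_algebraically_stable R A -> algebraically_stable R A.
Proof.
have iterE k D : iter k (pic_pullback A) (\pi_(Pic (P1n R n)) D)%qT =
    (\pi_(Pic (P1n R n)) (iter k (pullback A) D))%qT.
  by elim: k => //= k ->; exact: pic_pullback_pi.
move=> sA k k0 c; rewrite -[c]reprK iterE pic_pullback_pi; congr (\pi%qT _).
exact: sA.
Qed.

End NonnegativeMonomialMaps.

Theorem proposition5p6 (R : realType) (n : nat) (A : 'M[int]_n)
  (detA : \det A != 0) (A_ge0 : forall i j : 'I_n, 0 <= A i j) :
  strongly_algebraically_stable R A /\ algebraically_stable R A.
Proof.
have sA := nonneg_strongly_stable A A_ge0.
by split; last exact: strongly_stable_stable.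
Qed.
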